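(* Let $k\ge 2$, let $X_1,\dots,X_k$ be compact metrizable spaces with continuous maps $T_i:X_i\to X_i$ $(1\le i\le k)$, and let $\pi_i:X_i\to X_{i+1}$ $(1\le i\le k-1)$ be factor maps, i.e. continuous maps with $\pi_i\circ T_i=T_{i+1}\circ\pi_i$. Let $\mathbf a=(a_1,\dots,a_k)\in\mathbb R^k$ with $a_1>0$ and $a_i\ge 0$ for $2\le i\le k$. Then for any choice of metrics $d_i$ on $X_i$ compatible with the topology of $X_i$, $i=1,\dots,k$, $$\mathrm{mdim}^{\mathbf a}(X_1,T_1)\le \mathrm{mdim}^{\mathbf a}_M(X_1,d),$$ where $\mathrm{mdim}^{\mathbf a}(X_1,T_1)$ is the $\mathbf a$-weighted mean dimension and $\mathrm{mdim}^{\mathbf a}_M(X_1,d)$ is the $\mathbf a$-weighted metric mean dimension (with respect to $d=(d_1,\dots,d_k)$).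
   Context: Notation: $\pi_0=\mathrm{id}_{X_1}$ and $\tau_i=\pi_i\circ\pi_{i-1}\circ\cdots\circ\pi_0:X_1\to X_{i+1}$ for $0\le i\le k-1$. $\lceil u\rceil$ is the least integer $\ge u$. Covers: for finite open covers $\alpha,\beta$ of a compact metrizable space $X$, $\beta\succ\alpha$ ($\beta$ refines $\alpha$) means every member of $\beta$ is contained in some member of $\alpha$; $\alpha\vee\beta=\{U\cap V:U\in\alpha,V\in\beta\}$; for a continuous map $f$, $f^{-1}\alpha=\{f^{-1}(U):U\in\alpha\}$. Put $\mathrm{ord}(\alpha)=\max_{x\in X}\sum_{U\in\alpha}1_U(x)-1$ and $D(\alpha)=\min_{\beta\succ\alpha}\mathrm{ord}(\beta)$, where $\beta$ runs over all finite open covers of $X$ refining $\alpha$. Weighted mean dimension: $$\mathrm{mdim}^{\mathbf a}(X_1,T_1)=\sup_{\alpha_1,\dots,\alpha_k}\limsup_{n\to\infty}\frac1n D\Big(\bigvee_{i=1}^{k}\ \bigvee_{j=0}^{\lceil(a_1+\cdots+a_i)n\rceil-1}T_1^{-j}\tau_{i-1}^{-1}\alpha_i\Big),$$ where $\alpha_i$ runs over all finite open covers of $X_i$, $1\le i\le k$. Weighted metric mean dimension: for $n\in\mathbb N$ (positive integers) define the metric $d_n^{\mathbf a}$ on $X_1$ by $$d_n^{\mathbf a}(x,y)=\sup\{d_i(T_i^j\tau_{i-1}x,T_i^j\tau_{i-1}y):1\le i\le k,\ 0\le j\le\lceil(a_1+\cdots+a_i)n\rceil-1\}.$$ For a finite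 open cover $\alpha$ of $X_1$ let $\mathrm{mesh}(\alpha,d_n^{\mathbf a})=\max_{U\in\alpha}\mathrm{diam}(U)$, the diameter being taken with respect to $d_n^{\mathbf a}$. Let $$S^{\mathbf a}(X_1,\epsilon)=\limsup_{n\to\infty}\ \inf_{\mathrm{mesh}(\alpha,d_n^{\mathbf a})<\epsilon}\frac1n\log|\alpha|,\qquad \mathrm{mdim}^{\mathbf a}_M(X_1,d)=\liminf_{\epsilon\to0}\frac{S^{\mathbf a}(X_1,\epsilon)}{|\log\epsilon|},$$ where $\alpha$ runs over finite open covers of $X_1$ and $|\alpha|$ is the number of members of $\alpha$. All these quantities take values in $[0,\infty]$. *)

(* Defs.v *)
From mathcomp Require Import all_boot all_order all_algebra archimedean finmap.
From mathcomp Require Import all_classical all_reals all_analysis.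
Set Implicit Arguments.
Unset Strict Implicit.
Unset Printing Implicit Defensive.
Import Order.TTheory GRing.Theory Num.Theory.
Import numFieldNormedType.Exports.

Local Open Scope classical_set_scope.
Local Open Scope ring_scope.

Section Covers.
Context {R : realType}.

Definition finite_open_cover (X : topologicalType) (A : set_system X) : Prop :=
  [/\ finite_set A, (forall U, A U -> open U) & \bigcup_(U in A) U = setT].

Definition refines (X : Type) (B A : set_system X) : Prop :=
  forall V, B V -> exists2 U, A U & V `<=` U.

Definition cover_join (X : Type) (A B : set_system X) : set_system X :=
  [set U `&` V | U in A & V in B].

Definition cover_pullback (X Y : Type) (f : X -> Y) (A : set_system Y) :
  set_system X := [set f @^-1` U | U in A].

Definition cover_size (X : Type) (A : set_system X) : nat := #|` fset_set A|.

(* For a finite A the sums take finitely many values, so this sup is a max;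
   it is 0 when X is empty, since sup set0 = 0. *)
Definition cover_ord (X : Type) (A : set_system X) : R :=
  sup [set \sum_(U \in A) (\1_U x : R) - 1 | x in [set: X]].

(* The orders of covers are natural numbers, so this inf is a min. *)
Definition cover_D (X : topologicalType) (A : set_system X) : R :=
  inf [set cover_ord B | B in [set B | finite_open_cover B /\ refines B A]].

End Covers.

(* The spaces X_1, ..., X_k are X 0, ..., X k.-1, and likewise for the maps,
   the weights and the covers; pi i goes from X i to X i.+1, so that
   tau pi i : X 0 -> X i is the composite written tau_i (from X_1 to X_{i+1}).
   The families are indexed by nat only to avoid casts between the X i: the
   components of index >= k (>= k.-1 for pi) are not used below. *)
Fixpoint tau (X : nat -> Type) (pi : forall i, X i -> X i.+1) (i : nat) :
    X 0%N -> X i :=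
  if i is j.+1 then fun x => pi j (tau pi j x) else id.

Section Weighted.
Context {R : realType}.
Implicit Types (a : nat -> R) (k n : nat).

(* The ceiling is an int; it is nonnegative for the weights considered. *)
Definition weighted_length a (i n : nat) : nat :=
  `|Num.ceil ((\sum_(l < i.+1) a l) * n%:R)|%N.

Definition weighted_join (X : nat -> topologicalType)
    (T : forall i, X i -> X i) (pi : forall i, X i -> X i.+1) a k
    (alpha : forall i, set_system (X i)) n : set_system (X 0%N) :=
  \big[@cover_join _/[set setT]]_(i < k)
   \big[@cover_join _/[set setT]]_(j < weighted_length a i n)
     cover_pullback (iter j (T 0%N)) (cover_pullback (tau pi i) (alpha i)).

Definition weighted_mdim (X : nat -> topologicalType)
    (T : forall i, X i -> X i) (pi : forall i, X i -> X i.+1) a k : \bar R :=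
  ereal_sup
    [set limn_esup
           (fun n => (n%:R^-1 * cover_D (weighted_join T pi a k alpha n))%:E)
    | alpha in [set alpha : forall i, set_system (X i) |
                 forall i, (i < k)%N -> finite_open_cover (alpha i)]].

(* The sup is over finitely many nonnegative reals, hence the base value 0. *)
Definition weighted_dist (X : nat -> metricType R)
    (T : forall i, X i -> X i) (pi : forall i, X i -> X i.+1) a k n
    (x y : X 0%N) : R :=
  \big[Num.max/0]_(i < k) \big[Num.max/0]_(j < weighted_length a i n)
    mdist (iter j (T i) (tau pi i x)) (iter j (T i) (tau pi i y)).

(* Computed in \bar R, so an unbounded set has diameter +oo; the empty set has
   diameter -oo, which plays no role in conditions mesh < e with 0 < e. *)
Definition mesh (X : Type) (A : set_system X) (d : X -> X -> R) : \bar R :=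
  ereal_sup
    [set ereal_sup [set (d x y)%:E | x in U & y in U] | U in A].

Definition weighted_S (X : nat -> metricType R)
    (T : forall i, X i -> X i) (pi : forall i, X i -> X i.+1) a k (e : R) :
    \bar R :=
  limn_esup (fun n => ereal_inf
    [set (n%:R^-1 * ln (cover_size A)%:R)%:E
    | A in [set A : set_system (X 0%N) |
             finite_open_cover A /\
             (mesh A (weighted_dist T pi a k n) < e%:E)%E]]).

Definition weighted_mdimM (X : nat -> metricType R)
    (T : forall i, X i -> X i) (pi : forall i, X i -> X i.+1) a k : \bar R :=
  limf_einf (fun e : R => (weighted_S T pi a k e / `|ln e|%:E)%E) 0^'+.

End Weighted.

(* Main.v *)
(* Fix covers alpha_i with Lebesgue numbers bounded below by 2d and finite
   d-nets, and consider the N(n) = O(n) functions f_s(x) = d_i(c, T_i^j tau_i x),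
   with c in the i-th net. They are 1-Lipschitz for the weighted metric. Given a
   cover by P sets of mesh < e, place L ~ d/e levels at distance >= e in ]d, 2d[;
   each f_s meets at most one of them on each set of the cover. A counting
   argument then yields levels xi_s such that no point satisfies m of the
   equations f_s(x) = xi_s, as soon as P 2^N(n) < L^m. The arrangement of the
   level sets {f_s = xi_s} thus has strata of codimension < m only, and thickening
   the strata gives an open cover of order < m that refines the join of the
   alpha_i. Since m ~ (ln P + N(n) ln 2) / ln L and ln L = |ln e| + O(1), letting
   n tend to infinity and then e to 0 gives the inequality. *)

Require Import Defs.
From mathcomp Require Import all_boot all_order all_algebra.
From mathcomp Require Import archimedean finmap ring lra.
From mathcomp Require Import all_classical all_reals all_analysis.
Set Implicit Arguments.
Unset Strict Implicit.
Unset Printing Implicit Defensive.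
Import Order.TTheory GRing.Theory Num.Theory.
Import numFieldNormedType.Exports.

Local Open Scope classical_set_scope.
Local Open Scope ring_scope.

(** * Choice of generic levels by counting *)

(* Give [xi] the weight [#|T| ^ agreements] for each [j]: a random [xi] has
   average weight at most [2 ^ #|I|] per [j], so that some [xi] never reaches
   the weight [#|T| ^ m]. *)
Lemma exists_few_agreements (I J T : finType) (h : J -> I -> pred T) (m : nat) :
  (0 < #|T|)%N ->
  (forall j s t t', h j s t -> h j s t' -> t = t') ->
  (#|J| * 2 ^ #|I| < #|T| ^ m)%N ->
  exists xi : {ffun I -> T}, forall j, (#|[pred s | h j s (xi s)]| < m)%N.
Proof.
move=> T_gt0 h_inj small; apply: contrapT => /forallNP bad.
pose W (xi : {ffun I -> T}) := (\sum_j \prod_s #|T| ^ h j s (xi s))%N.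
have W_ge xi : (#|T| ^ m <= W xi)%N.
  have /existsNP[j /negP] := bad xi; rewrite -leqNgt => mj.
  rewrite /W (bigD1 j)//= (leq_trans _ (leq_addr _ _))//.
  rewrite -expn_sum (leq_trans (leq_pexp2l T_gt0 mj))// leq_pexp2l//.
  by rewrite -sum1_card big_mkcond/= leq_sum// => s _; rewrite inE; case: (h _ _ _).
have W_le : (\sum_xi W xi <= #|J| * 2 ^ #|I| * #|T| ^ #|I|)%N.
  rewrite exchange_big/= -mulnA -expnMn -sum_nat_const leq_sum// => j _.
  (* For fixed [j] and [s] at most one [t] is hit; it weighs [#|T|] and every other one weighs 1,
     whence the factor [2 * #|T|]. *)
  rewrite -(bigA_distr_bigA (fun s t => (#|T| ^ h j s t)%N)).
  rewrite -prod_nat_const leq_prod// => s _; rewrite mul2n -addnn.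
  have [t0 ht0|h0] := pickP (h j s); last first.
    rewrite (eq_bigr (fun=> 1%N)); last by move=> t _; rewrite h0.
    by rewrite sum1_card leq_addr.
  rewrite (bigD1 t0)//= ht0 expn1 leq_add2l.
  rewrite (eq_bigr (fun=> 1%N)).
    by rewrite sum1_card max_card.
  move=> t tt0; case: (boolP (h j s t)) => // ht.
  by rewrite (h_inj _ _ _ _ ht ht0) eqxx in tt0.
have : (\sum_(xi : {ffun I -> T}) #|T| ^ m <= \sum_xi W xi)%N by exact: leq_sum.
rewrite sum_nat_const card_ffun leqNgt => /negP; apply.
rewrite (leq_ltn_trans W_le)// [ltnRHS]mulnC ltn_pmul2r//.
by rewrite expn_gt0 T_gt0.
Qed.

(** With levels spaced by at least [eps], and [f s] varying by less than [eps] on each set of [A],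
    such a set meets at most one level of [f s]. The sets of [A] thus serve as the [J] of
    [exists_few_agreements]. *)
Lemma exists_generic_levels (R : realType) (I : finType) (X : Type)
    (f : I -> X -> R) (A : set_system X) (lo hi eps : R) (L m : nat) :
  finite_set A -> \bigcup_(U in A) U = setT ->
  (forall U s x y, A U -> U x -> U y -> `|f s x - f s y| < eps) ->
  lo < hi -> L.+1%:R * eps <= hi - lo -> (0 < L)%N ->
  (cover_size A * 2 ^ #|I| < L ^ m)%N ->
  exists xi : I -> R, (forall s, lo < xi s < hi) /\
    forall x, (#|[pred s | f s x == xi s]| < m)%N.
Proof.
move=> Afin Acov Aeps lohi Leps L_gt0 small.
(* Dividing by [L.+1] keeps the [L] levels strictly between [lo] and [hi]. *)
pose level (t : 'I_L) : R := lo + (hi - lo) * (t.+1%:R / L.+1%:R).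
have d_gt0 : 0 < (hi - lo) / L.+1%:R by rewrite divr_gt0 ?subr_gt0.
have eps_le : eps <= (hi - lo) / L.+1%:R.
  by rewrite ler_pdivlMr ?ltr0Sn// mulrC.
pose hit (U : fset_set A) s (t : 'I_L) := `[< exists2 x, val U x & f s x = level t >].
have AU (U : fset_set A) : A (val U).
  by have := valP U; rewrite in_fset_set// inE.
have level_sep (t t' : 'I_L) : (t < t')%N -> eps <= level t' - level t.
  move=> tt'; apply: (le_trans eps_le).
  have -> : level t' - level t = (t'%:R - t%:R) * ((hi - lo) / L.+1%:R).
    by rewrite /level -[t'.+1]addn1 -[t.+1]addn1 !natrD; ring.
  by rewrite ler_peMl ?(ltW d_gt0)// lerBrDr nat1r ler_nat.
have hit_inj U s t t' : hit U s t -> hit U s t' -> t = t'.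
  move=> /asboolP[x Ux xt] /asboolP[y Uy yt]; apply/val_inj => /=.
  have := Aeps _ s _ _ (AU U) Ux Uy; rewrite xt yt.
  case: (ltngtP t t') => // /level_sep sep near.
    by have := lt_le_trans near sep; rewrite distrC ltNge ler_norm.
  by have := lt_le_trans near sep; rewrite ltNge ler_norm.
have [||xi xiP] := exists_few_agreements (m := m) _ hit_inj.
- by rewrite card_ord.
- by rewrite card_ord -cardfE.
exists (level \o xi); split=> [s|x] /=.
  rewrite ltrDl mulr_gt0 ?subr_gt0 ?divr_gt0//=.
  rewrite -ltrBrDl gtr_pMr ?subr_gt0// ltr_pdivrMr// mul1r ltr_nat ltnS.
  exact: ltn_ord.
have [U AU' Ux] : (\bigcup_(U in A) U) x by rewrite Acov.
have UA : U \in fset_set A by rewrite in_fset_set// inE.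
apply: leq_ltn_trans (xiP [` UA]%fset).
apply/subset_leq_card/fintype.subsetP => s; rewrite !inE => /eqP fx.
by exists x.
Qed.

(** * Open cells around the strata of the arrangement *)

Section cells.
Context {R : realType} (I : finType) (X : topologicalType).
Variables (f : I -> X -> R) (xi : I -> R) (hi : R).

(* A thickening of the stratum where [f s x = xi s] holds for the [s] with
   [p s = None], and the signs of [f s x - xi s] at the other [s] are given
   by [p]. *)
Definition cell (p : {ffun I -> option bool}) : set X :=
  [set x | (forall s, match p s with
                      | None => f s x < hi
                      | Some true => xi s < f s x
                      | Some false => f s x < xi s
                      end) /\
           forall s s', p s = None -> p s' <> None ->
             `|f s x - xi s| < `|f s' x - xi s'|].

Definition cell_dim (p : {ffun I -> option bool}) : nat :=
  #|[pred s | p s == None]|.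

Lemma cell_open p : (forall s, continuous (f s)) -> open (cell p).
Proof.
move=> fcont; rewrite openE => x [H1 H2]; apply: filterI.
  apply: filter_forall => s; have := H1 s.
  case: (p s) => [[]|] fx.
  - exact: cvgr_gt _ (fcont s x) _ fx.
  - exact: cvgr_lt _ (fcont s x) _ fx.
  - exact: cvgr_lt _ (fcont s x) _ fx.
apply: filter_forall => s; apply: filter_forall => s'.
have [ps|ps] := eqVneq (p s) None; last first.
  by apply: nearW => y /eqP; rewrite (negPf ps).
have [ps'|ps'] := eqVneq (p s') None; first exact: nearW.
have lt0 := H2 _ _ ps (elimN eqP ps').
have dcont r : {for x, continuous (fun y => `|f r y - xi r|)}.
  apply: continuous_comp; last exact: norm_continuous.
  by apply: cvgB; [exact: fcont|exact: cvg_cst].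
have := cvgr_gt _ (cvgB (dcont s') (dcont s)) 0.
rewrite /= subr_gt0 => /(_ _ _ lt0); apply: filterS => y + _ _.
by rewrite subr_gt0.
Qed.

(* Within one dimension the [s] with [p s = None] are those where [f s x] is
   nearest to [xi s], so that they are determined by [x]. *)
Lemma cell_inj p q x : cell p x -> cell q x -> cell_dim p = cell_dim q -> p = q.
Proof.
move=> [p1 p2] [q1 q2] pq.
(* Two distinct sets of [None] indices of equal size each contain an index missing from the other;
   comparing the distances at these two indices is contradictory. *)
have pqN : [pred s | p s == None] =i [pred s | q s == None].
  apply/(subset_cardP pq)/negPn/negP => /fintype.subsetPn[s].
  rewrite !inE => /eqP ps /eqP qs.
  have /fintype.subsetPn[s'] :
      ~~ ([pred s | q s == None] \subset [pred s | p s == None]).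
    apply/negP => /(subset_cardP (esym pq))/(_ s).
    by rewrite !inE ps => /eqP.
  rewrite !inE => /eqP qs' /eqP ps'.
  by have := lt_trans (p2 _ _ ps ps') (q2 _ _ qs' qs); rewrite ltxx.
apply/ffunP => s; have := pqN s; rewrite !inE; have := p1 s; have := q1 s.
case: (p s) (q s) => [[]|] [[]|]//= h1 h2.
- by have := lt_trans h1 h2; rewrite ltxx.
- by have := lt_trans h1 h2; rewrite ltxx.
Qed.

Definition cells (m : nat) : set_system X :=
  [set cell p | p in [set p | (cell_dim p < m)%N /\ cell p !=set0]].

Lemma cells_cover m : (forall s, continuous (f s)) ->
  (forall s, xi s < hi) ->
  (forall x, (#|[pred s | f s x == xi s]| < m)%N) ->
  finite_open_cover (cells m).
Proof.
move=> fcont xihi few; split.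
- by apply: finite_image; exact: finite_finset.
- by move=> _ [p _ <-]; exact: cell_open.
- apply/seteqP; split=> // x _.
  (* The exact position of [x]: the distance to the level is zero at the [None] indices and positive
     elsewhere. *)
  pose p := [ffun s => if f s x == xi s then None else Some (xi s < f s x)].
  have px : cell p x.
    split=> [s|s s']; rewrite !ffunE.
      case: eqVneq => [->//|]; rewrite neq_lt.
      by case: ltgtP.
    case: eqVneq => // -> _; case: eqVneq => // fx _.
    by rewrite subrr normr0 normr_gt0 subr_eq0.
  exists (cell p) => //; exists p => //; split; last by exists x.
  apply: leq_ltn_trans (few x); apply/subset_leq_card/fintype.subsetP.
  by move=> s; rewrite !inE ffunE; case: ifP.
Qed.

(** By [cell_inj] the cells through a point have distinct dimensions, all below [m], so there are at
    most [m] of them. *)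
Lemma cells_ord m : (0 < m)%N -> cover_ord (cells m) <= m.-1%:R :> R.
Proof.
move=> m_gt0; have [[x0]|X0] := pselect (inhabited X); last first.
  rewrite /cover_ord (_ : [set _ | _ in _] = set0) ?sup0//.
  by apply/seteqP; split=> // y [x]; case: X0.
apply: ge_sup; first by apply/image_nonempty; exists x0.
move=> _ [x _ <-]; rewrite lerBlDr natr1 prednK//.
have fin : finite_set (cells m).
  by apply: finite_image; exact: finite_finset.
rewrite fsbig_finite//=.
rewrite (eq_bigr (fun U => (x \in U)%:R)) => [|U _]; last by rewrite indicE.
rewrite -natr_sum ler_nat (eq_bigr (fun U => if x \in U then 1 else 0)%N);
  last by move=> U _; case: (x \in U).
rewrite -big_mkcond sum1_count -size_filter.
(* Several patterns may define the same set; [P] fixes one for each cell. *)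
have /choice[P PP] (U : set X) : exists p, cells m U ->
    (cell_dim p < m)%N /\ cell p = U.
  have [[p [pm _] pU]|nU] := pselect (cells m U).
    by exists p.
  by exists [ffun=> None] => /nU.
set s := [seq U <- _ | _].
have sP U : U \in s -> cells m U /\ U x.
  by rewrite mem_filter in_fset_set// => /andP[]; rewrite !inE.
have d_inj : {in s &, injective (cell_dim \o P)}.
  move=> U V /sP[mU Ux] /sP[mV Vx] dUV.
  have [[_ PU] [_ PV]] := (PP _ mU, PP _ mV).
  rewrite -[LHS]PU -[RHS]PV; congr cell.
  by apply: (@cell_inj _ _ x); rewrite ?PU ?PV.
rewrite -(size_map (cell_dim \o P)) -[leqRHS](size_iota 0).
apply: uniq_leq_size; first by rewrite map_inj_in_uniq// filter_uniq// fset_uniq.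
by move=> _ /mapP[U /sP[mU _] ->]; rewrite mem_iota/=; have [] := PP _ mU.
Qed.
End cells.

Lemma cover_D_le (R : realType) (X : topologicalType) (A B : set_system X) :
  finite_open_cover B -> refines B A -> (cover_D A : R) <= cover_ord B.
Proof.
move=> Bcov BA; apply: ge_inf; last by exists B.
(* An empty sum minus 1 gives the lower bound [-1]; where there is no supremum, [sup] defaults to
   0. *)
exists (-1) => _ [C _ <-]; rewrite /cover_ord.
set E := (X in sup X).
have [[[_ [x _ _]] Eub]|/sup_out ->] := pselect (has_sup E).
  apply: (@le_trans _ _ (\sum_(U \in C) (\1_U x : R) - 1)).
    rewrite lerBrDl subrr; apply: sumr_ge0 => U _.
    by rewrite indicE ler0n.
  by apply: ub_le_sup => //; exists x.
exact: lerN10.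
Qed.

(** * Lebesgue numbers and finite nets *)

Section metric.
Context {R : realType} {X : metricType R}.

Lemma mdist_dist_le (c x y : X) : `|mdist c x - mdist c y| <= mdist x y.
Proof.
rewrite ler_norml lerBrDl lerBlDr; apply/andP; split.
  exact: metric_triangle.
by rewrite lerBlDr addrC [mdist x y]metric_sym metric_triangle.
Qed.

Lemma mdist_continuous (c : X) : continuous (mdist c : X -> R).
Proof.
move=> x; apply/cvgrPdist_lt => e e0.
near=> y; apply: le_lt_trans (mdist_dist_le _ _ _) _.
by near: y; apply: metricType_numDomainType.cvgr_dist_lt (@cvg_id _ _) _ e0.
Unshelve. all: by end_near. Qed.

(** Holding for all small positive [d], the property can be intersected over finitely many
    spaces. *)
Lemma lebesgue_number (A : set_system X) :
  compact [set: X] -> finite_open_cover A ->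
  \forall d \near 0^'+, forall x,
    exists2 U, A U & forall y, mdist x y < d -> U y.
Proof.
move=> /compact_near_coveringP Xc [_ Aop Acov].
suff: \forall d \near 0^'+, [set: X] `<=`
    [set x | exists2 U, A U & forall y, mdist x y < d -> U y].
  by apply: filterS => d h x; exact: h.
apply: Xc => x _; have [U AU Ux] : (\bigcup_(U in A) U) x by rewrite Acov.
have : \near x, U x by apply: open_nbhs_nbhs; split => //; exact: Aop.
rewrite metricType_numDomainType.nbhs_mdistP => -[e /= e0 eU].
exists ([set y | mdist x y < e / 2], [set d | d < e / 2]) => /=.
  split; last by apply: nbhs_right_lt; rewrite divr_gt0.
  by apply: metricType_numDomainType.cvgr_dist_lt (@cvg_id _ _) _ _;
    rewrite divr_gt0.
move=> [y d]/= [xy de]; exists U => // z yz; apply: eU => /=.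
apply: le_lt_trans (metric_triangle _ y _) _.
by rewrite [e]splitr ltrD// (lt_trans yz).
Qed.

Lemma compact_net (d : R) : compact [set: X] -> 0 < d ->
  exists s : seq X, forall x, exists2 c, c \in s & mdist c x < d.
Proof.
move=> /compact_near_coveringP Xc d0.
(* Along this filter a list eventually contains any given point, so the near-covering form of
   compactness yields one list good for all [x]. *)
pose F := filter_from [set: seq X] (fun s => [set t : seq X | {subset s <= t}]).
have FF : Filter F.
  apply: filter_from_filter; first by exists [::].
  move=> s t _ _; exists (s ++ t) => // u /= stu.
  by split=> x xs; apply: stu; rewrite mem_cat xs ?orbT.
suff [s _ sP] : \forall s \near F, [set: X] `<=`
    [set x | exists2 c, c \in s & mdist c x < d].
  by exists s => x; exact: (sP s).
apply: Xc => x _; exists ([set y | mdist x y < d], [set s : seq X | x \in s]) => /=.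
  split; first exact: metricType_numDomainType.cvgr_dist_lt (@cvg_id _ _) _ d0.
  by exists [:: x] => // s /= h; apply: h; rewrite inE.
by move=> [y s]/= [xy xs]; exists x.
Qed.

End metric.

(** * Covers of small order refining the weighted join *)

Lemma cover_join_superset (X : Type) (J : finType) (P : pred J)
    (A : J -> set_system X) (V : set X) :
  (forall j, P j -> exists2 U, A j U & V `<=` U) ->
  exists2 U, (\big[@cover_join _/[set setT]]_(j | P j) A j) U & V `<=` U.
Proof.
move=> AV; elim/big_rec : _ => [|j B Pj [U BU VU]]; first by exists setT.
have [W AW VW] := AV j Pj; exists (W `&` U); last by rewrite subsetI.
by exists W => //; exists U.
Qed.

Lemma mesh_lt_dist (R : realType) (X : Type) (A : set_system X) (d : X -> X -> R)
    (e : R) U x y :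
  (mesh A d < e%:E)%E -> A U -> U x -> U y -> d x y < e.
Proof.
move=> Ae AU Ux Uy; rewrite -lte_fin; apply: le_lt_trans Ae.
apply: ereal_sup_ge; exists (ereal_sup [set (d x y)%:E | x in U & y in U]).
  by exists U.
by apply: ereal_sup_ge; exists (d x y)%:E => //; exists x => //; exists y.
Qed.

Section weighted.
Context {R : realType}.
Variables (k : nat) (X : nat -> metricType R) (T : forall i, X i -> X i).
Variables (pi : forall i, X i -> X i.+1) (a : nat -> R).
Arguments pi : clear implicits.
Arguments T : clear implicits.
Hypothesis Tcont : forall i, (i < k)%N -> continuous (T i).
Hypothesis picont : forall i, (i.+1 < k)%N -> continuous (pi i).
Hypothesis piT :
  forall i, (i.+1 < k)%N -> forall x, pi i (T i x) = T i.+1 (pi i x).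

Lemma tau_iter i : (i < k)%N ->
  forall j x, tau pi i (iter j (T 0%N) x) = iter j (T i) (tau pi i x).
Proof.
move=> ik j x; elim: j => //= j <-; move: (iter _ _ _) => {}x.
by elim: i ik => //= i IH ik; rewrite IH ?piT// ltnW.
Qed.

Lemma tau_continuous i : (i < k)%N -> continuous (tau pi i).
Proof.
elim: i => [_ x|i IH ik x]; first exact: cvg_id.
by apply: continuous_comp; [apply: IH; exact: ltnW|exact: picont].
Qed.

Lemma iter_continuous i j : (i < k)%N -> continuous (iter j (T i)).
Proof.
move=> ik; elim: j => [x|j IH x]; first exact: cvg_id.
by apply: continuous_comp; [exact: IH|exact: Tcont].
Qed.

Lemma mdist_le_weighted_dist n i j x y : (i < k)%N ->
  (j < weighted_length a i n)%N ->
  mdist (iter j (T i) (tau pi i x)) (iter j (T i) (tau pi i y)) <=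
  weighted_dist T pi a k n x y.
Proof.
move=> ik jl; rewrite /weighted_dist.
apply: le_trans (le_bigmax _ _ (Ordinal ik)).
exact: (le_bigmax _ _ (Ordinal jl)).
Qed.

Lemma cover_D_weighted_join_le (alpha : forall i, set_system (X i))
    (net : forall i, seq (X i)) (A : set_system (X 0%N)) (d e : R) (n L m : nat) :
  0 < d ->
  (forall i, (i < k)%N -> forall c,
    exists2 U, alpha i U & forall y, mdist c y < d + d -> U y) ->
  (forall i, (i < k)%N -> forall x, exists2 c, c \in net i & mdist c x < d) ->
  finite_open_cover A -> (mesh A (weighted_dist T pi a k n) < e%:E)%E ->
  L.+1%:R * e <= d -> (0 < L)%N -> (0 < m)%N ->
  (cover_size A * 2 ^ (\sum_(i < k) weighted_length a i n * size (net i))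
    < L ^ m)%N ->
  cover_D (weighted_join (X := fun i => X i) T pi a k alpha n) <= m.-1%:R :> R.
Proof.
move=> d0 alphaU netP [Afin Aop Acov] Ae Le L0 m0 small.
pose I : finType := {i : 'I_k & ('I_(weighted_length a i n) * 'I_(size (net i)))%type}.
pose f (s : I) (x : X 0%N) : R :=
  mdist (tnth (in_tuple (net (tag s))) (tagged s).2)
        (iter (tagged s).1 (T (tag s)) (tau pi (tag s) x)).
have fcont s : continuous (f s).
  case: s => i [j u] x; rewrite /f/=.
  apply: (@continuous_comp _ _ _ (fun y => iter j (T i) (tau pi i y))
    (mdist (tnth (in_tuple (net i)) u))); last exact: mdist_continuous.
  apply: (@continuous_comp _ _ _ (tau pi i) (iter j (T i))).
    exact: tau_continuous.
  exact: iter_continuous.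
have fA U s x y : A U -> U x -> U y -> `|f s x - f s y| < e.
  move=> AU Ux Uy; apply: le_lt_trans (mesh_lt_dist Ae AU Ux Uy).
  exact: le_trans (mdist_dist_le _ _ _) (mdist_le_weighted_dist _ _ _ _).
have cardI : #|I| = (\sum_(i < k) weighted_length a i n * size (net i))%N.
  rewrite card_tagged sumnE big_map big_enum/=.
  by apply: eq_bigr => i _; rewrite card_prod !card_ord.
have [||||xi [xid few]] := exists_generic_levels (lo := d) (hi := d + d)
    (L := L) (m := m) Afin Acov fA.
- by rewrite ltrDl.
- by rewrite addrK.
- by [].
- by rewrite cardI.
have xihi s : xi s < d + d by case/andP: (xid s).
apply: (le_trans _ (cells_ord f xi (d + d) m0)).
apply: cover_D_le; first exact: cells_cover.
move=> _ [p [_ [x px]] <-].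
apply: cover_join_superset => i _; apply: cover_join_superset => j _.
(* Since [f s x < d < xi s] at a point [x] of the cell, the pattern at [s] is not [Some true].
   Either remaining value bounds [f s] by [d + d] on the whole cell, which therefore stays in the
   member of [alpha i] around [c]. *)
have [c] := netP i (ltn_ord i) (iter j (T i) (tau pi i x)).
move=> /[dup] cnet; rewrite -index_mem => ci cx.
pose s : I := Tagged (fun i : 'I_k =>
  ('I_(weighted_length a i n) * 'I_(size (net i)))%type) (j, Ordinal ci).
have fsE y : f s y = mdist c (iter j (T i) (tau pi i y)).
  by rewrite /f/= (tnth_nth c)/= nth_index.
have [U aU cU] := alphaU i (ltn_ord i) c.
exists (iter j (T 0%N) @^-1` (tau pi i @^-1` U)).
  by exists (tau pi i @^-1` U) => //; exists U.
move=> y [/(_ s) ys _] /=; rewrite tau_iter//; apply: cU; rewrite -fsE.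
have := px.1 s; move: ys; case: (p s) => [[]|//] ys xs.
  rewrite fsE in xs; have := lt_trans xs cx.
  by rewrite ltNge ltW//; case/andP: (xid s).
exact: lt_trans ys _.
Qed.

End weighted.

(** * Upper and lower limits, and the choice of exponents *)

Lemma limn_esup_lt_near (R : realType) (u : nat -> \bar R) (x : \bar R) :
  (limn_esup u < x)%E -> \forall n \near \oo, (u n < x)%E.
Proof.
rewrite /limn_esup limf_esupE => /ereal_inf_lt[_ [V Voo <-] Vx].
apply: filterS Voo => n Vn; apply: le_lt_trans Vx.
by apply: ereal_sup_ge; exists (u n) => //; exists n.
Qed.

Lemma limn_esup_le_near (R : realType) (u : nat -> \bar R) (x : \bar R) :
  (\forall n \near \oo, u n <= x)%E -> (limn_esup u <= x)%E.
Proof.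
move=> ux; rewrite /limn_esup limf_esupE; apply: ereal_inf_le.
exists (ereal_sup [set u n | n in [set n | (u n <= x)%E]]).
  by exists [set n | (u n <= x)%E].
by apply: ge_ereal_sup => _ [n /= ? <-].
Qed.

Lemma limf_einf_lt_exists (R : realType) (T : choiceType) (X : filteredType T)
    (f : X -> \bar R) (F : set_system X) (x : \bar R) (V : set X) :
  (limf_einf f F < x)%E -> F V -> exists2 e, V e & (f e < x)%E.
Proof.
rewrite limf_einfE => fx FV.
have /ereal_inf_lt[_ [e Ve <-] fex] : (ereal_inf (f @` V) < x)%E.
  by apply: le_lt_trans fx; apply: ereal_sup_ge; exists (ereal_inf (f @` V)) => //; exists V.
by exists e.
Qed.

(** The ceiling adds less than 1, which is at most [n]. *)
Lemma weighted_length_le (R : realType) (a : nat -> R) (i n : nat) :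
  0 <= \sum_(l < i.+1) a l -> (0 < n)%N ->
  (weighted_length a i n)%:R <= (\sum_(l < i.+1) a l + 1) * n%:R.
Proof.
move=> b0 n0; rewrite /weighted_length; set b := (\sum_(_ < _) _) in b0 *.
have c0 : 0 <= b * n%:R by rewrite mulr_ge0.
rewrite natr_absz ger0_norm ?ceil_ge0//; last by rewrite (lt_le_trans _ c0)// ltrN10.
rewrite mulrDl mul1r -lerBlDr.
apply: (@le_trans _ _ ((Num.ceil (b * n%:R) - 1)%:~R)).
  by rewrite intrB lerB// ler1n.
exact/ltW/ceilB1_lt.
Qed.

(* [L + 1] levels at distance at least [e] fit into an interval of length [d],
   with [ln L >= - ln e - O(1)]. *)
Lemma exists_exponent (R : realType) (r eta K d e : R) :
  0 < eta -> 0 < e -> e < 1 -> 4 * e <= d ->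
  0 <= r -> K * ln 2 - (r + eta) * ln (d / 2) <= eta * - ln e ->
  exists2 L : nat, (0 < L)%N /\ L.+1%:R * e <= d &
    forall n P M : nat, (0 < n)%N -> ln P%:R <= n%:R * (r * - ln e) ->
      M%:R <= K * n%:R ->
      exists2 m : nat, (0 < m)%N /\ (P * 2 ^ M < L ^ m)%N &
        n%:R^-1 * m.-1%:R <= r + eta.
Proof.
move=> eta0 e0 e1 ed r0 Kd.
have d0 : 0 < d by apply: lt_le_trans ed; rewrite mulr_gt0.
have de4 : 4 <= d / e by rewrite ler_pdivlMr.
have de0 : 0 <= d / e by apply: le_trans de4.
have t4 : (4 <= Num.truncn (d / e))%N by rewrite truncn_ge_nat.
(* The largest [L] with [L.+1 * e <= d]. As [d / e >= 4], both [L >= 3] and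
   [L > d / e - 2 >= d / (2 * e)] hold. *)
pose L := (Num.truncn (d / e)).-1.
have LE : L.+1 = Num.truncn (d / e) by rewrite prednK// (leq_trans _ t4).
have L_ge : d / 2 / e <= L%:R.
  have h : d / e < L%:R + 1 + 1 by rewrite !natr1 LE truncnS_gt.
  have -> : d / 2 / e = d / e / 2 by rewrite mulrAC.
  by move: (d / e) de4 h => z; lra.
have lnL : ln (d / 2) - ln e <= ln L%:R.
  rewrite -ln_div ?posrE ?divr_gt0// ler_ln ?posrE ?divr_gt0//.
  by rewrite ltr0n -ltnS LE (leq_trans _ t4).
have lnL0 : 0 < ln L%:R :> R.
  by rewrite ln_gt0// ltr1n -ltnS LE (leq_trans _ t4).
exists L.
  split; first by rewrite -ltnS LE (leq_trans _ t4).
  by rewrite LE -ler_pdivlMr// truncn_le.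
move=> n P M n0 lnP MK.
have nR0 : 0 < n%:R :> R by rewrite ltr0n.
pose w : R := ln P%:R + M%:R * ln 2.
have ln2_0 : 0 <= ln 2 :> R by rewrite ln_ge0// ler1n.
have lnP0 : 0 <= ln P%:R :> R.
  by case: (P) => [|p]; [rewrite ln0|rewrite ln_ge0// ler1n].
have w0 : 0 <= w / ln L%:R by rewrite divr_ge0 ?(ltW lnL0)// addr_ge0// mulr_ge0.
(* The least [m] with [w < m * ln L], so that [m.-1 <= w / ln L]. The case [P = 0] is separate
   because [ln 0 = 0]. *)
exists (Num.truncn (w / ln L%:R)).+1.
  split=> //; have [->|P0] := posnP P.
    by rewrite mul0n expn_gt0 -ltnS LE (leq_trans _ t4).
  have L0 : (0 < L)%N by rewrite -ltnS LE (leq_trans _ t4).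
  rewrite -(ltr_nat R) natrM !natrX -ltr_ln ?posrE ?mulr_gt0 ?exprn_gt0 ?ltr0n//.
  rewrite lnM ?posrE ?exprn_gt0 ?ltr0n//.
  rewrite !lnXn ?ltr0n// -[ln 2 *+ _]mulr_natl -[ln L%:R *+ _]mulr_natl.
  by rewrite -ltr_pdivrMr// truncnS_gt.
rewrite ler_pdivrMl//=.
apply: (@le_trans _ _ (w / ln L%:R)); first by rewrite truncn_le.
rewrite ler_pdivrMr//.
have wle : w <= n%:R * (r * - ln e + K * ln 2).
  rewrite mulrDr lerD// mulrA ler_wpM2r//.
  by rewrite mulrC.
apply: (le_trans wle); rewrite -mulrA ler_wpM2l ?(ltW nR0)//.
have reta : 0 <= r + eta by rewrite addr_ge0// ltW.
have := ler_wpM2l reta lnL; lra.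
Qed.

Lemma ereal_le_of_upper_bounds (R : realType) (x y : \bar R) :
  (forall r : R, y < r%:E -> x <= r%:E)%E -> (x <= y)%E.
Proof.
move=> h; rewrite leNgt; apply/negP => yx.
case: y x yx h => [y| |] [x| |]//=.
- rewrite lte_fin => yx /(_ ((y + x) / 2)); rewrite lte_fin lee_fin.
  by rewrite midf_lt// => /(_ isT); rewrite leNgt midf_lt.
- by move=> _ /(_ (y + 1)); rewrite lte_fin ltrDl ltr01 leye_eq => /(_ isT).
- move=> _ /(_ (x - 1)); rewrite ltNyr lee_fin => /(_ isT).
  by rewrite lerBrDl gerDr ler10.
- by move=> _ /(_ 0); rewrite ltNyr leye_eq => /(_ isT).
Qed.

(** * Passage to the limits in [n] and [e] *)

Theorem theorem1p4 (R : realType) (k : nat) (hk : (2 <= k)%N)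
  (X : nat -> metricType R)
  (T : forall i, X i -> X i)
  (pi : forall i, X i -> X i.+1)
  (a : nat -> R)
  (Xcompact : forall i, (i < k)%N -> compact [set: X i])
  (Tcont : forall i, (i < k)%N -> continuous (T i))
  (picont : forall i, (i.+1 < k)%N -> continuous (pi i))
  (piT : forall i, (i.+1 < k)%N -> forall x, pi i (T i x) = T i.+1 (pi i x))
  (a_gt0 : 0 < a 0%N)
  (a_ge0 : forall i, (0 < i < k)%N -> 0 <= a i) :
  (weighted_mdim (X := fun i => X i) T pi a k <= weighted_mdimM T pi a k)%E.
Proof.
apply: ge_ereal_sup => _ [alpha alphacov <-].
apply: ereal_le_of_upper_bounds => r mdimM_lt.
apply/lee_addgt0Pr => eta eta0; rewrite -EFinD.
(* Half of a common Lebesgue number: the levels will lie between [d] and [d + d]. *)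
have [d d0 alphaU] : exists2 d : R, 0 < d & forall i, (i < k)%N ->
    forall c, exists2 U, alpha i U & forall y : X i, mdist c y < d + d -> U y.
  have leb (i : 'I_k) := lebesgue_number (Xcompact i (ltn_ord i))
    (alphacov i (ltn_ord i)).
  have d_near : \forall d \near 0^'+, 0 < d /\ forall (i : 'I_k) (x : X i),
      exists2 U, alpha i U & forall y : X i, mdist x y < d -> U y.
    apply: filterI; [exact: nbhs_right_gt|].
    exact: (filter_forall _ leb).
  have [d [d0 dP]] := filter_ex d_near; exists (d / 2); first by rewrite divr_gt0.
  by move=> i ik c; have := dP (Ordinal ik) c; rewrite -splitr.
have netE i : exists s : seq (X i), (i < k)%N ->
    forall x, exists2 c, c \in s & mdist c x < d.
  have [ik|_] := ltnP i k; last by exists [::].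
  by have [s sP] := compact_net (Xcompact i ik) d0; exists s.
pose net i := sval (cid (netE i)).
have netP i : (i < k)%N -> forall x, exists2 c, c \in net i & mdist c x < d.
  exact: (svalP (cid (netE i))).
have b_ge0 i : (i < k)%N -> 0 <= \sum_(l < i.+1) a l.
  move=> ik; apply: sumr_ge0 => -[[|l] /= li] _; first exact: ltW.
  by apply: a_ge0; rewrite /= (leq_trans _ ik).
(* [K * n] bounds the number of distance functions; [B] gathers the terms free of [e], which
   [eta * - ln e] absorbs once [e] is small. *)
pose K := \sum_(i < k) (\sum_(l < i.+1) a l + 1) * (size (net i))%:R.
pose B := K * ln 2 - (r + eta) * ln (d / 2).
pose V : set R := [set e | [/\ 0 < e, e < 1, 4 * e <= d & B <= eta * - ln e]].
have V_near : (0^'+)%classic V.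
  near=> e; have e0 : 0 < e by [].
  split=> //.
  - rewrite mulrC -ler_pdivlMr// ltW//.
    by near: e; apply: nbhs_right_lt; rewrite divr_gt0.
  - rewrite mulrC -ler_pdivrMr// lerNr -[leRHS]expRK ler_ln ?posrE ?expR_gt0//.
    by rewrite ltW//; near: e; apply: nbhs_right_lt; exact: expR_gt0.
have [e [e0 e1 ed eB]] := limf_einf_lt_exists mdimM_lt V_near.
have lne0 : 0 < - ln e by rewrite oppr_gt0 ln_lt0// e0.
(* As [e < 1], [|ln e|] is [- ln e], and the quotient bound becomes
   [weighted_S T pi a k e < r * - ln e]. *)
rewrite -normrN gtr0_norm// inver gt_eqF// lte_pdivrMr// -EFinM.
move=> /limn_esup_lt_near S_near.
(* [r * - ln e] exceeds some [n^-1 * ln (cover_size A)], nonnegative even for size 0 since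
   [ln 0 = 0]. *)
have r0 : 0 <= r.
  have [n] := filter_ex S_near.
  move=> /ereal_inf_lt[_ [A _ <-]]; rewrite lte_fin => Ar.
  rewrite -(pmulr_lge0 _ lne0) (le_trans _ (ltW Ar))// mulr_ge0//.
  by case: (cover_size A) => [|p]; [rewrite ln0|rewrite ln_ge0// ler1n].
have [L [L0 Le] LP] := exists_exponent eta0 e0 e1 ed r0 eB.
apply: limn_esup_le_near; near=> n; rewrite lee_fin.
have n0 : (0 < n)%N by near: n; exact: nbhs_infty_gt.
have : (ereal_inf [set (n%:R^-1 * ln (cover_size A)%:R)%:E
    | A in [set A : set_system (X 0%N) |
             finite_open_cover A /\
             (mesh A (weighted_dist T pi a k n) < e%:E)%E]] < (r * - ln e)%:E)%E.
  by near: n; exact: S_near.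
move=> /ereal_inf_lt[_ [A [Acov Ae] <-]]; rewrite lte_fin.
rewrite ltr_pdivrMl ?ltr0n// => /ltW lnA.
pose M := (\sum_(i < k) weighted_length a i n * size (net i))%N.
have MK : M%:R <= K * n%:R.
  rewrite natr_sum mulr_suml ler_sum// => i _.
  by rewrite natrM mulrAC ler_wpM2r// weighted_length_le// b_ge0.
have [m [m0 small]] := LP n (cover_size A) M n0 lnA MK.
apply: le_trans; rewrite ler_wpM2l ?invr_ge0//.
exact: (cover_D_weighted_join_le Tcont picont piT d0 alphaU netP Acov Ae Le).
Unshelve. all: by end_near. Qed.
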